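(* Let $\mathbb D=\{(x,y)\in\mathbb R^2:x^2+y^2\le1\}$ with the Euclidean metric and $\Delta$ the Euclidean Laplacian. For $r\in(0,1]$ let $d_A(r)=-(\tanh(\alpha(r))-\alpha(r))$ with $\alpha(r)=\cosh^{-1}(1/r)$. Then for all $k\in\mathbb N$ there exist $\psi_k\in C^\infty(\mathbb D)\cap H^1_0(\mathbb D)$ and $\lambda_k\ge0$ with $$\lambda_k=k^2+O(k^{4/3}),\qquad\|\psi_k\|_{L^2(\mathbb D)}=1,\qquad-\Delta\psi_k=\lambda_k\psi_k,$$ and there exist $C,\beta,k_0>0$ such that for all $k\ge k_0$ and $0<r\le1-\beta\lambda_k^{-1/3}$, $$\|\psi_k\|_{L^\infty(B(0,r))}\le\exp\left(-(\sqrt{\lambda_k}-C\lambda_k^{1/6})d_A(r)+C\lambda_k^{1/6}\right).$$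
   Context: $B(0,r)$ is the Euclidean disk of radius $r$ centered at the origin. *)

(* Defs.v *)
From Stdlib Require Import Reals Lra List.
From Coquelicot Require Import Coquelicot.
Open Scope R_scope.

Definition arcosh (x : R) : R := ln (x + sqrt (x * x - 1)).

Definition alphaA (r : R) : R := arcosh (/ r).
Definition dA (r : R) : R := - (tanh (alphaA r) - alphaA r).

Definition partial (b : bool) (f : R -> R -> R) : R -> R -> R :=
  if b then fun x y => Derive (fun t => f t y) x
  else fun x y => Derive (fun t => f x t) y.

Definition partial_exists (b : bool) (f : R -> R -> R) (x y : R) : Prop :=
  if b then ex_derive (fun t => f t y) x else ex_derive (fun t => f x t) y.

Fixpoint iter_partial (w : list bool) (f : R -> R -> R) : R -> R -> R :=
  match w with
  | nil => f
  | b :: w' => partial b (iter_partial w' f)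
  end.

Definition smooth_on (U : R -> R -> Prop) (f : R -> R -> R) : Prop :=
  forall w x y, U x y ->
    (forall b, partial_exists b (iter_partial w f) x y) /\
    continuous (fun p : R * R => iter_partial w f (fst p) (snd p)) (x, y).

(* C^infinity on the closed unit disk D: smooth on an open neighbourhood
   {x^2 + y^2 < 1 + eps} of D (smooth up to the boundary). *)
Definition smooth_closed_disk (f : R -> R -> R) : Prop :=
  exists eps, 0 < eps /\ smooth_on (fun x y => x ^ 2 + y ^ 2 < 1 + eps) f.

Definition laplacian (f : R -> R -> R) : R -> R -> R :=
  fun x y => partial true (partial true f) x y + partial false (partial false f) x y.

Definition L2sq_disk (f : R -> R -> R) : R :=
  RInt (fun x => RInt (fun y => (f x y) ^ 2) (- sqrt (1 - x ^ 2)) (sqrt (1 - x ^ 2))) (-1) 1.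

(* Main.v *)
(* psi_k = c J_k(j rho) cos(k theta), where j is a zero of J_k, and lambda_k = j^2.  The function
   f = J_k satisfies f_tt = (k^2 - z^2) f in t = ln z, so Sturm comparison gives a zero j with
   k <= j <= k + O(k^(1/3)).  Integrating the derivatives of f f_t and f_t^2 - (k^2 - z^2) f^2
   from t = -infinity gives f_t >= sqrt(k^2 - z^2) f > 0 for 0 < z < k, which integrates to
   f(kr) <= f(k) exp(-k dA(r)).  The L^2 normalization costs only a factor exp(O(k^(1/3))), because
   psi_k is at least exp(-O(k^(1/3))) times its value at (k/j, 0) on a box near that point whose
   sides are at least exp(-O(k^(1/3))). *)
Require Import Defs.
From Stdlib Require Import Reals Lra Lia Psatz List Classical.
From Stdlib Require Import FunctionalExtensionality IndefiniteDescription.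
From Coquelicot Require Import Coquelicot.
Open Scope R_scope.

(** Writing J_k(z) as a multiple of z^k F(z^2), with F = [bessel k] entire, turns the singular end t
    = -infinity into the ordinary point s = z^2 = 0. The quantities integrated from there carry a
    factor s^k or s^(k+1) and so start at 0. The same form makes the mode a polynomial times an
    entire function of x^2 + y^2, hence smooth at the origin. All losses are measured by nu =
    j^(1/3), which equals lambda^(1/6), the size of error that the theorem allows. With j - k <= c
    nu, the condition r <= 1 - c lambda^(-1/3) gives j r <= j - c mu <= k, where mu = k^(1/3): the
    circle of radius r stays on the monotone side of the turning point z = k. The decay estimate
    naturally produces the radius j r / k, measured from the turning point, whereas dA is evaluated
    at r. Monotonicity of ln(1 + q) - q makes this exchange favourable, and the remaining mismatch
    between k and j in front of dA is absorbed by C. *)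

Lemma exp_le (x y : R) : x <= y -> exp x <= exp y.
Proof. intros [H | ->]; [left; now apply exp_increasing | lra]. Qed.

Lemma le_of_derive_nonneg (f df : R -> R) (a b : R) :
  a <= b -> (forall x, a <= x <= b -> is_derive f x (df x)) ->
  (forall x, a < x < b -> 0 <= df x) -> f a <= f b.
Proof.
intros Hab Hd Hn.
destruct (Rle_lt_or_eq_dec a b Hab) as [Hlt | <-]; [|lra].
destruct (MVT_cor2 f df a b Hlt) as [c [Hc Hin]].
  intros c Hc. apply is_derive_Reals. now apply Hd.
specialize (Hn c Hin). nra.
Qed.

(** * Entire power series and the Bessel series *)

Lemma entire_is_derive (a : nat -> R) (Ha : CV_radius a = p_infty) (x : R) :
  is_derive (PSeries a) x (PSeries (PS_derive a) x).
Proof. apply is_derive_PSeries. now rewrite Ha. Qed.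

Lemma entire_ex_pseries (a : nat -> R) (Ha : CV_radius a = p_infty) (x : R) : ex_pseries a x.
Proof. apply CV_radius_inside. now rewrite Ha. Qed.

Lemma entire_PS_derive (a : nat -> R) (Ha : CV_radius a = p_infty) :
  CV_radius (PS_derive a) = p_infty.
Proof. now rewrite CV_radius_derive. Qed.

Lemma entire_continuous (a : nat -> R) (Ha : CV_radius a = p_infty) (x : R) :
  continuous (PSeries a) x.
Proof.
apply (ex_derive_continuous (V := R_NormedModule)). eexists. now apply entire_is_derive.
Qed.

(** In closed form (-1)^m k! / (4^m m! (m+k)!): the Taylor coefficients of J_k in s = z^2 after
    removing z^k, normalized to constant term 1. *)
Fixpoint bessel_coef (k m : nat) : R :=
  match m with
  | O => 1
  | S m => - bessel_coef k m / (4 * INR (S m) * INR (S m + k))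
  end.

(* [J_k(z)] is a constant multiple of [z ^ k * bessel k (z ^ 2)]. *)
Definition bessel (k : nat) : R -> R := PSeries (bessel_coef k).
Definition bessel' (k : nat) : R -> R := PSeries (PS_derive (bessel_coef k)).
Definition bessel'' (k : nat) : R -> R := PSeries (PS_derive (PS_derive (bessel_coef k))).

Lemma bessel_coef_neq_0 (k m : nat) : bessel_coef k m <> 0.
Proof.
induction m as [|m IH]; [simpl; lra|].
assert (H1 := lt_0_INR (S m) ltac:(lia)). assert (H2 := lt_0_INR (S m + k) ltac:(lia)).
cbn [bessel_coef]. apply Rmult_integral_contrapositive. split; [lra|].
apply Rinv_neq_0_compat. nra.
Qed.

Lemma bessel_coef_entire (k : nat) : CV_radius (bessel_coef k) = p_infty.
Proof.
apply CV_radius_infinite_DAlembert; [apply bessel_coef_neq_0|].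
apply is_lim_seq_le_le with (u := fun _ => 0) (w := fun n => / INR (S n)).
- intros n. split; [apply Rabs_pos|].
  assert (H0 := bessel_coef_neq_0 k n).
  assert (H1 := lt_0_INR (S n) ltac:(lia)). assert (H2 : 1 <= INR (S n + k)).
    apply (le_INR 1); lia.
  assert (HH : 0 < 4 * INR (S n) * INR (S n + k)) by nra.
  replace (bessel_coef k (S n) / bessel_coef k n) with (- / (4 * INR (S n) * INR (S n + k))).
  2: { cbn [bessel_coef]. field. repeat split; lra. }
  rewrite Rabs_Ropp, Rabs_pos_eq by (left; now apply Rinv_0_lt_compat).
  apply Rinv_le_contravar; nra.
- apply is_lim_seq_const.
- replace (Finite 0) with (Rbar_inv p_infty) by reflexivity.
  apply is_lim_seq_inv; [|discriminate].
  apply -> is_lim_seq_incr_1. apply is_lim_seq_INR.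
Qed.

Lemma bessel_derive (k : nat) (s : R) : is_derive (bessel k) s (bessel' k s).
Proof. apply entire_is_derive, bessel_coef_entire. Qed.

Lemma bessel'_derive (k : nat) (s : R) : is_derive (bessel' k) s (bessel'' k s).
Proof. apply entire_is_derive, entire_PS_derive, bessel_coef_entire. Qed.

Lemma Derive_bessel (k : nat) (s : R) : Derive (fun x : R => bessel k x) s = bessel' k s.
Proof. apply is_derive_unique, bessel_derive. Qed.

Lemma Derive_bessel' (k : nat) (s : R) : Derive (fun x : R => bessel' k x) s = bessel'' k s.
Proof. apply is_derive_unique, bessel'_derive. Qed.

Lemma bessel_0 (k : nat) : bessel k 0 = 1.
Proof. unfold bessel. now rewrite PSeries_0. Qed.

(** Bessel's equation for z^k F(z^2), written in s = z^2. Comparing coefficients of s^n reduces it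
    to (n+1)(n+1+k) a_(n+1) = -a_n / 4, the recurrence defining [bessel_coef]; n = 0 is separate
    because s F'' has no constant term. *)
Lemma bessel_ode (k : nat) (s : R) :
  s * bessel'' k s + (INR k + 1) * bessel' k s + bessel k s / 4 = 0.
Proof.
unfold bessel, bessel', bessel''.
assert (E0 := bessel_coef_entire k). assert (E1 := entire_PS_derive _ E0).
assert (E2 := entire_PS_derive _ E1).
rewrite <- PSeries_incr_1, <- PSeries_scal.
replace (PSeries (bessel_coef k) s / 4) with (PSeries (PS_scal (/ 4) (bessel_coef k)) s)
  by (rewrite PSeries_scal; field).
rewrite <- PSeries_plus, <- PSeries_plus.
- rewrite <- (PSeries_const_0 s). apply PSeries_ext. intros n.
  assert (H : forall m, INR (S m) * INR (S m + k) * bessel_coef k (S m) = - bessel_coef k m / 4).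
  { intros m.
    assert (H1 := lt_0_INR (S m) ltac:(lia)). assert (H2 := lt_0_INR (S m + k) ltac:(lia)).
    cbn [bessel_coef]. field. lra. }
  specialize (H n). rewrite plus_INR, S_INR in H.
  destruct n as [|n].
  + unfold PS_plus, PS_scal, PS_incr_1, PS_derive, plus, scal, zero. simpl. unfold mult. simpl.
    simpl in H. lra.
  + unfold PS_plus, PS_scal, PS_incr_1, PS_derive, plus, scal. cbn -[bessel_coef INR].
    unfold mult. cbn -[bessel_coef INR].
    rewrite (S_INR (S n)). set (c := bessel_coef k (S (S n))) in *. lra.
- apply ex_pseries_plus.
  + apply ex_pseries_incr_1, entire_ex_pseries, E2.
  + apply ex_pseries_scal; [apply Rmult_comm|]. apply entire_ex_pseries, E1.
- apply ex_pseries_scal; [apply Rmult_comm|]. apply entire_ex_pseries, E0.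
- apply ex_pseries_incr_1, entire_ex_pseries, E2.
- apply ex_pseries_scal; [apply Rmult_comm|]. apply entire_ex_pseries, E1.
Qed.

(* [besselH k (z ^ 2)] is [z ^ (1 - k)] times the derivative of [z ^ k * bessel k (z ^ 2)]. *)
Definition besselH (k : nat) (s : R) : R := INR k * bessel k s + 2 * s * bessel' k s.

Lemma besselH_derive (k : nat) (s : R) :
  is_derive (besselH k) s (- INR k * bessel' k s - bessel k s / 2).
Proof.
replace (- INR k * bessel' k s - bessel k s / 2)
  with (INR k * bessel' k s + 2 * bessel' k s + 2 * s * bessel'' k s)
  by (assert (H := bessel_ode k s); lra).
unfold besselH. auto_derive.
- repeat split; eexists; [apply bessel_derive | apply bessel'_derive].
- rewrite Derive_bessel.
  rewrite Derive_bessel'. ring.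
Qed.

Lemma Derive_besselH (k : nat) (s : R) :
  Derive (fun x : R => besselH k x) s = - INR k * bessel' k s - bessel k s / 2.
Proof. apply is_derive_unique, besselH_derive. Qed.

(* For [f z = z ^ k * bessel k (z ^ 2)] and [t = ln z] the next two lemmas integrate
   [(f f_t)_t = f_t ^ 2 + (k ^ 2 - z ^ 2) f ^ 2] and
   [(f_t ^ 2 - (k ^ 2 - z ^ 2) f ^ 2)_t = 2 z ^ 2 f ^ 2] from [t = - infinity]. *)
Lemma bessel_mul_besselH_nonneg (k : nat) (s : R) :
  (1 <= k)%nat -> 0 < s <= INR k ^ 2 -> 0 <= bessel k s * besselH k s.
Proof.
intros Hk [Hs0 Hs].
assert (H : 0 ^ k * bessel k 0 * besselH k 0 <= s ^ k * bessel k s * besselH k s).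
{ apply (le_of_derive_nonneg (fun s => s ^ k * bessel k s * besselH k s)
    (fun s => s ^ pred k / 2 * (besselH k s ^ 2 + (INR k ^ 2 - s) * bessel k s ^ 2))); [lra| |].
  - intros x _. auto_derive.
    + repeat split; eexists; [apply bessel_derive | apply besselH_derive].
    + rewrite Derive_bessel.
      rewrite Derive_besselH.
      destruct k as [|n]; [lia|]. cbn [pred]. rewrite <- tech_pow_Rmult. unfold besselH. field.
  - intros x Hx. assert (0 < x ^ pred k) by (apply pow_lt; lra).
    apply Rmult_le_pos; [lra|].
    assert (0 <= bessel k x ^ 2) by apply pow2_ge_0.
    assert (0 <= besselH k x ^ 2) by apply pow2_ge_0. nra. }
rewrite pow_i in H by lia. assert (0 < s ^ k) by (apply pow_lt; lra). nra.
Qed.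

Lemma besselH_sqr_ge (k : nat) (s : R) :
  (1 <= k)%nat -> 0 < s -> (INR k ^ 2 - s) * bessel k s ^ 2 <= besselH k s ^ 2.
Proof.
intros Hk Hs.
assert (H : 0 ^ k * (besselH k 0 ^ 2 - (INR k ^ 2 - 0) * bessel k 0 ^ 2)
  <= s ^ k * (besselH k s ^ 2 - (INR k ^ 2 - s) * bessel k s ^ 2)).
{ apply (le_of_derive_nonneg
    (fun s => s ^ k * (besselH k s ^ 2 - (INR k ^ 2 - s) * bessel k s ^ 2))
    (fun s => s ^ k * bessel k s ^ 2)); [lra| |].
  - intros x _. auto_derive.
    + repeat split; eexists; [apply besselH_derive | apply bessel_derive].
    + rewrite Derive_bessel.
      rewrite Derive_besselH.
      destruct k as [|n]; [lia|]. cbn [pred]. rewrite <- tech_pow_Rmult. unfold besselH. field.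
  - intros x Hx. apply Rmult_le_pos; [apply pow_le; lra | apply pow2_ge_0]. }
rewrite pow_i in H by lia. assert (0 < s ^ k) by (apply pow_lt; lra). nra.
Qed.

(** * Sign, monotonicity and decay up to the turning point s = k^2 *)

Lemma bessel_sqr_incr (k : nat) (s1 s2 : R) : (1 <= k)%nat ->
  0 <= s1 <= s2 -> s2 <= INR k ^ 2 -> s1 ^ k * bessel k s1 ^ 2 <= s2 ^ k * bessel k s2 ^ 2.
Proof.
intros Hk Hs Hs2.
apply (le_of_derive_nonneg (fun s => s ^ k * bessel k s ^ 2)
  (fun s => s ^ pred k * (bessel k s * besselH k s))); [lra| |].
- intros x _. auto_derive.
  + eexists; apply bessel_derive.
  + rewrite Derive_bessel.
    destruct k as [|n]; [lia|]. cbn [pred]. rewrite <- tech_pow_Rmult. unfold besselH. ring.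
- intros x Hx. apply Rmult_le_pos; [apply pow_le; lra|].
  apply bessel_mul_besselH_nonneg; [easy|lra].
Qed.

Lemma bessel_continuity (k : nat) : continuity (bessel k).
Proof.
intros s. apply continuity_pt_filterlim. apply entire_continuous, bessel_coef_entire.
Qed.

(** A zero z would force the nonnegative, nondecreasing quantity s^k F(s)^2 to vanish on all of (0,
    z], but F(0) = 1 keeps F above 1/2 near 0. *)
Lemma bessel_pos (k : nat) (s : R) : (1 <= k)%nat -> 0 <= s <= INR k ^ 2 -> 0 < bessel k s.
Proof.
intros Hk Hs. apply Rnot_le_lt. intros Hneg.
destruct (IVT_gen (bessel k) 0 s 0) as [z [Hz Fz]]; [apply bessel_continuity| |].
  rewrite bessel_0, Rmin_right, Rmax_left; lra.
rewrite Rmin_left, Rmax_right in Hz by lra.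
assert (Hz0 : z <> 0) by (intros ->; rewrite bessel_0 in Fz; lra).
destruct (bessel_continuity k 0 (1/2) ltac:(lra)) as [d [Hd Hc]].
set (x := Rmin (d / 2) z).
assert (Hx : 0 < x <= z /\ x < d).
{ unfold x. split; [split; [apply Rmin_glb_lt; lra | apply Rmin_r]|].
  apply Rle_lt_trans with (1 := Rmin_l _ _); lra. }
assert (Hb : 1 / 2 < bessel k x).
{ specialize (Hc x). simpl in Hc. unfold R_dist in Hc. rewrite bessel_0 in Hc.
  assert (Rabs (bessel k x - 1) < 1 / 2).
  { apply Hc. split; [split; [exact I | apply Rlt_not_eq; lra] |].
    rewrite Rminus_0_r, Rabs_pos_eq; lra. }
  apply Rabs_def2 in H. lra. }
assert (H := bessel_sqr_incr k x z Hk ltac:(lra) ltac:(lra)). rewrite Fz in H.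
assert (0 < x ^ k) by (apply pow_lt; lra).
assert (0 < x ^ k * bessel k x ^ 2) by (apply Rmult_lt_0_compat; nra). lra.
Qed.

(** The equation in divergence form reads (s^(k+1) F')' = -s^k F / 4, whose right side is negative
    while F is positive. *)
Lemma bessel'_nonpos (k : nat) (s : R) : (1 <= k)%nat -> 0 < s <= INR k ^ 2 -> bessel' k s <= 0.
Proof.
intros Hk Hs.
assert (H : - (0 ^ S k * bessel' k 0) <= - (s ^ S k * bessel' k s)).
{ apply (le_of_derive_nonneg (fun s => - (s ^ S k * bessel' k s))
    (fun s => s ^ k * bessel k s / 4)); [lra| |].
  - intros x _.
    replace (x ^ k * bessel k x / 4) with (- x ^ k * (x * bessel'' k x + (INR k + 1) * bessel' k x))
      by (assert (H := bessel_ode k x); nra).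
    rewrite <- S_INR. auto_derive.
    + eexists; apply bessel'_derive.
    + rewrite Derive_bessel'. destruct k as [|n]; [lia|]. cbv iota. rewrite !S_INR. ring.
  - intros x Hx. assert (0 < x ^ k) by (apply pow_lt; lra).
    assert (0 < bessel k x) by (apply bessel_pos; [easy|lra]). nra. }
rewrite pow_i in H by lia. assert (0 < s ^ S k) by (apply pow_lt; lra). nra.
Qed.

Lemma bessel_decr (k : nat) (s1 s2 : R) : (1 <= k)%nat ->
  0 <= s1 <= s2 -> s2 <= INR k ^ 2 -> bessel k s2 <= bessel k s1.
Proof.
intros Hk Hs Hs2. apply Ropp_le_cancel.
apply (le_of_derive_nonneg (fun s => - bessel k s) (fun s => - bessel' k s)); [lra| |].
- intros x _. apply (is_derive_opp (bessel k)), bessel_derive.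
- intros x Hx. assert (bessel' k x <= 0) by (apply bessel'_nonpos; [easy|lra]). lra.
Qed.

(** The square root of [besselH_sqr_ge], taken at z = k sqrt(1 - q^2) so that sqrt(k^2 - z^2)
    becomes k q; [bessel_mul_besselH_nonneg] selects the nonnegative root. *)
Lemma besselH_ge (k : nat) (q : R) : (1 <= k)%nat -> 0 <= q < 1 ->
  INR k * q * bessel k (INR k ^ 2 * (1 - q ^ 2)) <= besselH k (INR k ^ 2 * (1 - q ^ 2)).
Proof.
intros Hk Hq. set (s := INR k ^ 2 * (1 - q ^ 2)).
assert (HK : 1 <= INR k) by (apply (le_INR 1); easy).
assert (Hk2 : 0 < INR k ^ 2) by nra. assert (Hq2 : 0 <= q ^ 2 < 1) by nra.
assert (Hs : 0 < s <= INR k ^ 2) by (unfold s; nra).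
assert (HF := bessel_pos k s Hk ltac:(lra)).
assert (HFH := bessel_mul_besselH_nonneg k s Hk Hs).
assert (HH : 0 <= besselH k s) by nra.
assert (HE := besselH_sqr_ge k s Hk ltac:(lra)).
apply Rsqr_incr_0_var; [|exact HH].
unfold Rsqr. replace (INR k ^ 2 - s) with (INR k ^ 2 * q ^ 2) in HE by (unfold s; ring). lra.
Qed.

(** Integrates [besselH_ge] in q from the turning point q = 0. For q = sqrt(1 - r^2), the quantity
    ln(1 + q) - q is dA(r) + ln r; the term ln r belongs to the factor z^k, which [bessel] leaves
    out. *)
Lemma bessel_decay (k : nat) (q : R) : (1 <= k)%nat -> 0 <= q < 1 ->
  bessel k (INR k ^ 2 * (1 - q ^ 2)) <= bessel k (INR k ^ 2) * exp (- INR k * (ln (1 + q) - q)).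
Proof.
intros Hk Hq. assert (HK : 1 <= INR k) by (apply (le_INR 1); easy).
set (G := fun q => - (bessel k (INR k ^ 2 * (1 - q ^ 2)) * exp (INR k * (ln (1 + q) - q)))).
assert (H : G 0 <= G q).
{ apply (le_of_derive_nonneg G (fun q => exp (INR k * (ln (1 + q) - q)) * (q / (1 + q)) *
    (INR k * bessel k (INR k ^ 2 * (1 - q ^ 2))
     + 2 * INR k ^ 2 * (1 + q) * bessel' k (INR k ^ 2 * (1 - q ^ 2))))); [lra| |].
  - intros x Hx. unfold G. auto_derive.
    + repeat split; [eexists; apply bessel_derive | lra].
    + rewrite Derive_bessel.
      replace (INR k * (INR k * 1) * (1 + - (x * (x * 1)))) with (INR k ^ 2 * (1 - x ^ 2)) by ring.
      unfold Rminus. field. lra.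
  - intros x Hx. apply Rmult_le_pos.
    + apply Rmult_le_pos; [left; apply exp_pos | apply Rdiv_le_0_compat; lra].
    + assert (HH := besselH_ge k x Hk ltac:(lra)). unfold besselH in HH.
      set (F := bessel k (INR k ^ 2 * (1 - x ^ 2))) in *.
      set (F' := bessel' k (INR k ^ 2 * (1 - x ^ 2))) in *.
      (* The factor 1 - x turns 1 + x into 1 - x^2, and the bracket becomes [besselH] minus k x F at
         s = k^2 (1 - x^2). *)
      apply Rmult_le_reg_l with (1 - x); [lra|]. lra. }
unfold G in H. rewrite Rplus_0_r, ln_1, Rminus_0_r, Rmult_0_r, exp_0 in H.
replace (INR k ^ 2 * (1 - 0 ^ 2)) with (INR k ^ 2) in H by ring.
rewrite Ropp_mult_distr_l_reverse, exp_Ropp.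
assert (He := exp_pos (INR k * (ln (1 + q) - q))).
apply Rmult_le_reg_r with (1 := He). rewrite Rmult_assoc, Rinv_l; lra.
Qed.

(** * A zero of the Bessel function close to k *)

(* Sturm comparison of [f t = e^(k t) * bessel k (e^(2 t))], which satisfies
   [f'' = (k ^ 2 - e^(2 t)) f], with [sin (mu ^ 2 * (t - a))], where [a = ln k + / mu ^ 2]. *)
Lemma bessel_zero (k : nat) (mu : R) : (1 <= k)%nat -> 0 < mu -> mu ^ 3 = INR k ->
  exists j, INR k <= j <= INR k * exp (5 / mu ^ 2) /\ bessel k (j ^ 2) = 0.
Proof.
intros Hk Hmu Hmk. assert (HK : 1 <= INR k) by (apply (le_INR 1); easy).
(* The frequency w = k^(2/3) balances the two scales: moving t by 1 / w past ln k raises e^(2t) -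
   k^2 to at least 2 k^2 / w = 2 w^2, enough to beat w^2, while the half period pi / w moves j by
   only O(k / w) = O(k^(1/3)). *)
set (w := mu ^ 2). assert (Hw : 0 < w) by (unfold w; nra).
assert (Hiw : 0 < / w) by now apply Rinv_0_lt_compat.
(* The window ends at t = ln k + (1 + pi) / w, and 2 (1 + pi) <= 10 because pi <= 4. *)
set (smax := INR k ^ 2 * exp (10 / w)).
assert (Hex : exists s, INR k ^ 2 <= s <= smax /\ bessel k s <= 0).
{ apply NNPP. intros Hno.
  assert (Hpos : forall s, INR k ^ 2 <= s <= smax -> 0 < bessel k s).
  { intros s Hs. apply Rnot_le_lt. intros Hle. apply Hno. now exists s. }
  set (a := ln (INR k) + / w). set (b := a + PI * / w).
  assert (HPI := PI_RGT_0). assert (HPI4 := PI_4).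
  assert (Hab : a < b) by (unfold b; nra).
  assert (Hrange : forall t, a <= t <= b -> INR k ^ 2 + 2 * w ^ 2 <= exp (2 * t) <= smax).
  { intros t Ht.
    assert (Hk2 : INR k ^ 2 = exp (2 * ln (INR k))).
    { replace (2 * ln (INR k)) with (ln (INR k) + ln (INR k)) by ring.
      rewrite exp_plus, exp_ln by lra. ring. }
    split.
    - apply Rle_trans with (exp (2 * a)).
      + unfold a. rewrite Rmult_plus_distr_l, exp_plus, <- Hk2.
        assert (H := exp_ineq1_le (2 * / w)).
        assert (H2 : INR k ^ 2 * (2 * / w) = 2 * w ^ 2).
        { rewrite <- Hmk. unfold w. field. lra. }
        assert (0 < INR k ^ 2) by nra. nra.
      + apply exp_le; lra.
    - unfold smax. rewrite Hk2, <- exp_plus.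
      assert (Hle : 2 * t <= 2 * ln (INR k) + 10 / w) by (unfold b, a, Rdiv in *; nra).
      now apply exp_le. }
  set (f := fun t => exp (INR k * t) * bessel k (exp (2 * t))).
  set (f' := fun t => exp (INR k * t) * besselH k (exp (2 * t))).
  (* Wronskian of f with the comparison sine. If f stayed positive, W would be nondecreasing on
     [a, b], yet it equals w f(a) > 0 at a and -w f(b) < 0 at b. *)
  set (W := fun t => f t * w * cos (w * (t - a)) - f' t * sin (w * (t - a))).
  assert (HW : W a <= W b).
  { apply (le_of_derive_nonneg W
      (fun t => (exp (2 * t) - INR k ^ 2 - w ^ 2) * f t * sin (w * (t - a)))); [lra| |].
    - intros t _. unfold W, f, f'. auto_derive.
      + repeat split; eexists; [apply bessel_derive | apply besselH_derive].
      + rewrite Derive_bessel, Derive_besselH. unfold besselH, Rminus. field.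
    - intros t Ht. specialize (Hrange t ltac:(lra)).
      assert (Hf : 0 < f t).
      { apply Rmult_lt_0_compat; [apply exp_pos|]. apply Hpos. nra. }
      apply Rmult_le_pos; [apply Rmult_le_pos; [nra|lra]|].
      apply sin_ge_0; [nra|].
      apply Rle_trans with (w * (PI * / w)); [unfold b in Ht; nra | right; field; lra]. }
  unfold W in HW. replace (w * (b - a)) with PI in HW by (unfold b; field; lra).
  rewrite Rminus_diag, Rmult_0_r, cos_0, sin_0, cos_PI, sin_PI in HW.
  assert (Hfa : 0 < f a).
  { apply Rmult_lt_0_compat; [apply exp_pos|]. apply Hpos. specialize (Hrange a). nra. }
  assert (Hfb : 0 < f b).
  { apply Rmult_lt_0_compat; [apply exp_pos|]. apply Hpos. specialize (Hrange b). nra. }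
  nra. }
destruct Hex as [s [Hs Fs]].
destruct (IVT_gen (bessel k) (INR k ^ 2) s 0) as [z [Hz Fz]]; [apply bessel_continuity| |].
{ assert (H := bessel_pos k (INR k ^ 2) Hk ltac:(nra)). rewrite Rmin_right, Rmax_left; lra. }
rewrite Rmin_left, Rmax_right in Hz by lra.
assert (Hz0 : 0 <= z) by nra.
exists (sqrt z). rewrite pow2_sqrt by easy. split; [|easy]. split.
- rewrite <- (sqrt_pow2 (INR k)) by lra. apply sqrt_le_1_alt. lra.
- rewrite <- (sqrt_pow2 (INR k * exp (5 / w))).
  + apply sqrt_le_1_alt. apply Rle_trans with smax; [lra|]. unfold smax. right.
    rewrite Rpow_mult_distr. f_equal. simpl. rewrite Rmult_1_r, <- exp_plus. f_equal. field. lra.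
  + apply Rmult_le_pos; [lra | left; apply exp_pos].
Qed.

Lemma exp_minus_1_le (y M : R) : 0 <= y <= M -> exp y - 1 <= y * exp M.
Proof.
intros Hy. assert (H := exp_ineq1_le (- y)). rewrite exp_Ropp in H.
assert (He := exp_pos y).
assert (HM : exp y <= exp M) by now apply exp_le.
apply Rmult_le_compat_r with (r := exp y) in H; [|lra]. rewrite Rinv_l in H by lra. nra.
Qed.

(** Since mu >= 1, the exponent y = 5 / mu^2 is at most 5, so e^y - 1 <= y e^5, and k y = 5 mu. *)
Lemma bessel_zero_near (k : nat) (mu : R) : (1 <= k)%nat -> 0 < mu -> mu ^ 3 = INR k ->
  exists j, INR k <= j <= INR k + 5 * exp 5 * mu /\ bessel k (j ^ 2) = 0.
Proof.
intros Hk Hmu Hmk. assert (HK : 1 <= INR k) by (apply (le_INR 1); easy).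
destruct (bessel_zero k mu Hk Hmu Hmk) as [j [Hj Fj]]. exists j. split; [|easy].
split; [easy|]. apply Rle_trans with (1 := proj2 Hj).
assert (Hmu1 : 1 <= mu) by (apply Rnot_lt_le; intros Hlt; nra).
assert (Hy : 0 <= 5 / mu ^ 2 <= 5).
{ split; [apply Rdiv_le_0_compat; nra|]. apply Rle_div_l; nra. }
assert (H := exp_minus_1_le _ _ Hy).
assert (HE : INR k * (5 / mu ^ 2) = 5 * mu) by (rewrite <- Hmk; field; lra).
assert (He := exp_pos 5). nra.
Qed.

(** * Harmonic polynomials and the eigenvalue equation *)

Definition zre (k : nat) (x y : R) : R := Re (Cpow (x, y) k).
Definition zim (k : nat) (x y : R) : R := Im (Cpow (x, y) k).

Lemma zre_S (k : nat) (x y : R) : zre (S k) x y = x * zre k x y - y * zim k x y.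
Proof. reflexivity. Qed.

Lemma zim_S (k : nat) (x y : R) : zim (S k) x y = x * zim k x y + y * zre k x y.
Proof. reflexivity. Qed.

Lemma zre_zim_sqr (k : nat) (x y : R) : zre k x y ^ 2 + zim k x y ^ 2 = (x ^ 2 + y ^ 2) ^ k.
Proof.
induction k as [|k IH]; [unfold zre, zim; simpl; ring|].
rewrite zre_S, zim_S. cbn [pow] in *. rewrite <- IH. ring.
Qed.

(** Near the positive x-axis, Re (x + iy)^k is close to x^k: each multiplication by x + iy scales
    the old error by |x| <= 1 and adds at most |y|, since the imaginary part stays bounded by 1. *)
Lemma zre_ge (k : nat) (x y : R) : x ^ 2 + y ^ 2 <= 1 -> x ^ k - INR k * Rabs y <= zre k x y.
Proof.
intros Hxy.
assert (Hx : Rabs x <= 1) by (apply Rabs_le; nra).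
assert (Him : forall n, Rabs (zim n x y) <= 1).
{ intros n. assert (H := zre_zim_sqr n x y).
  assert (H1 : (x ^ 2 + y ^ 2) ^ n <= 1) by (rewrite <- (pow1 n); apply pow_incr; nra).
  apply Rabs_le. nra. }
enough (H : Rabs (zre k x y - x ^ k) <= INR k * Rabs y) by (apply Rabs_le_between in H; lra).
induction k as [|k IH].
- unfold zre. simpl. rewrite Rminus_diag, Rabs_R0. lra.
- rewrite zre_S, S_INR, <- tech_pow_Rmult.
  replace (x * zre k x y - y * zim k x y - x * x ^ k)
    with (x * (zre k x y - x ^ k) + - (y * zim k x y)) by ring.
  apply Rle_trans with (1 := Rabs_triang _ _). rewrite Rabs_Ropp, !Rabs_mult.
  specialize (Him k). assert (H0 := Rabs_pos y). assert (H1 := Rabs_pos (zre k x y - x ^ k)).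
  assert (H2 := Rabs_pos (zim k x y)). assert (H3 := Rabs_pos x). nra.
Qed.

(** Real and imaginary parts of (z^k)' = k z^(k-1), proved jointly because the recurrences couple
    them. At k = 0 the factor [INR 0] hides the default [pred 0 = 0]. *)
Lemma zre_zim_derive_x (k : nat) (x y : R) :
  is_derive (fun t => zre k t y) x (INR k * zre (pred k) x y) /\
  is_derive (fun t => zim k t y) x (INR k * zim (pred k) x y).
Proof.
induction k as [|k [IH1 IH2]].
- unfold zre, zim. simpl. split; auto_derive; trivial; ring.
- assert (E1 : Derive (fun t : R => zre k t y) x = INR k * zre (pred k) x y)
    by now apply is_derive_unique.
  assert (E2 : Derive (fun t : R => zim k t y) x = INR k * zim (pred k) x y)
    by now apply is_derive_unique.
  assert (D1 : ex_derive (fun t => zre k t y) x) by (eexists; exact IH1).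
  assert (D2 : ex_derive (fun t => zim k t y) x) by (eexists; exact IH2).
  rewrite S_INR; cbn [pred]. split.
  + apply (is_derive_ext (fun t => t * zre k t y - y * zim k t y)); [easy|].
    auto_derive; [easy|]. rewrite E1, E2.
    destruct k as [|k]; [simpl; ring|]. rewrite S_INR, zre_S; cbn [pred]. ring.
  + apply (is_derive_ext (fun t => t * zim k t y + y * zre k t y)); [easy|].
    auto_derive; [easy|]. rewrite E1, E2.
    destruct k as [|k]; [simpl; ring|]. rewrite S_INR, zim_S; cbn [pred]. ring.
Qed.

Lemma zre_zim_derive_y (k : nat) (x y : R) :
  is_derive (fun t => zre k x t) y (- INR k * zim (pred k) x y) /\
  is_derive (fun t => zim k x t) y (INR k * zre (pred k) x y).
Proof.
induction k as [|k [IH1 IH2]].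
- unfold zre, zim. simpl. split; auto_derive; trivial; ring.
- assert (E1 : Derive (fun t : R => zre k x t) y = - INR k * zim (pred k) x y)
    by now apply is_derive_unique.
  assert (E2 : Derive (fun t : R => zim k x t) y = INR k * zre (pred k) x y)
    by now apply is_derive_unique.
  assert (D1 : ex_derive (fun t => zre k x t) y) by (eexists; exact IH1).
  assert (D2 : ex_derive (fun t => zim k x t) y) by (eexists; exact IH2).
  rewrite S_INR; cbn [pred]. split.
  + apply (is_derive_ext (fun t => x * zre k x t - t * zim k x t)); [easy|].
    auto_derive; [easy|]. rewrite E1, E2.
    destruct k as [|k]; [simpl; ring|]. rewrite S_INR, zim_S; cbn [pred]. ring.
  + apply (is_derive_ext (fun t => x * zim k x t + t * zre k x t)); [easy|].
    auto_derive; [easy|]. rewrite E1, E2.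
    destruct k as [|k]; [simpl; ring|]. rewrite S_INR, zre_S; cbn [pred]. ring.
Qed.

Ltac ex_derives := repeat match goal with
  | |- _ /\ _ => split
  | |- True => exact I
  | |- ex_derive (fun t => zre _ t _) _ => eexists; apply (proj1 (zre_zim_derive_x _ _ _))
  | |- ex_derive (fun t => zre _ _ t) _ => eexists; apply (proj1 (zre_zim_derive_y _ _ _))
  | |- ex_derive (fun t => zim _ _ t) _ => eexists; apply (proj2 (zre_zim_derive_y _ _ _))
  | |- ex_derive (fun t => bessel _ t) _ => eexists; apply bessel_derive
  | |- ex_derive (fun t => bessel' _ t) _ => eexists; apply bessel'_derive
  end.

Lemma Derive_zre_x (k : nat) (x y : R) :
  Derive (fun t : R => zre k t y) x = INR k * zre (pred k) x y.
Proof. apply is_derive_unique, zre_zim_derive_x. Qed.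

Lemma Derive_zre_y (k : nat) (x y : R) :
  Derive (fun t : R => zre k x t) y = - INR k * zim (pred k) x y.
Proof. apply is_derive_unique, zre_zim_derive_y. Qed.

Lemma Derive_zim_y (k : nat) (x y : R) :
  Derive (fun t : R => zim k x t) y = INR k * zre (pred k) x y.
Proof. apply is_derive_unique, zre_zim_derive_y. Qed.

(** For lam = j^2 this is a multiple of J_k(j rho) cos(k theta), in a Cartesian form that is regular
    at the origin. *)
Definition mode (k : nat) (lam c : R) (x y : R) : R :=
  c * (zre k x y * bessel k (lam * (x ^ 2 + y ^ 2))).

(** The second derivatives of the harmonic factor cancel, Euler's identity for a homogeneous
    polynomial of degree k turns the mixed terms into a multiple of [zre k], and what remains is
    [bessel_ode]. *)
Lemma laplacian_mode (k : nat) (lam c x y : R) :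
  - laplacian (mode k lam c) x y = lam * mode k lam c x y.
Proof.
unfold laplacian.
assert (Ex : partial true (mode k lam c) = fun x y =>
  c * (INR k * zre (pred k) x y * bessel k (lam * (x ^ 2 + y ^ 2))
       + 2 * lam * x * zre k x y * bessel' k (lam * (x ^ 2 + y ^ 2)))).
{ apply functional_extensionality; intros u. apply functional_extensionality; intros v.
  unfold partial, mode. apply is_derive_unique. auto_derive.
  - ex_derives.
  - rewrite Derive_zre_x, Derive_bessel.
    replace (u * (u * 1) + v * (v * 1)) with (u ^ 2 + v ^ 2) by ring. ring. }
assert (Ey : partial false (mode k lam c) = fun x y =>
  c * (- INR k * zim (pred k) x y * bessel k (lam * (x ^ 2 + y ^ 2))
       + 2 * lam * y * zre k x y * bessel' k (lam * (x ^ 2 + y ^ 2)))).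
{ apply functional_extensionality; intros u. apply functional_extensionality; intros v.
  unfold partial, mode. apply is_derive_unique. auto_derive.
  - ex_derives.
  - rewrite Derive_zre_y, Derive_bessel.
    replace (u * (u * 1) + v * (v * 1)) with (u ^ 2 + v ^ 2) by ring. ring. }
rewrite Ex, Ey.
assert (Exx : partial true (fun x y =>
  c * (INR k * zre (pred k) x y * bessel k (lam * (x ^ 2 + y ^ 2))
       + 2 * lam * x * zre k x y * bessel' k (lam * (x ^ 2 + y ^ 2)))) x y =
  c * (INR k * INR (pred k) * zre (pred (pred k)) x y * bessel k (lam * (x ^ 2 + y ^ 2))
       + (4 * lam * INR k * x * zre (pred k) x y + 2 * lam * zre k x y)
         * bessel' k (lam * (x ^ 2 + y ^ 2))
       + 4 * lam ^ 2 * x ^ 2 * zre k x y * bessel'' k (lam * (x ^ 2 + y ^ 2)))).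
{ unfold partial. apply is_derive_unique. auto_derive.
  - ex_derives.
  - rewrite !Derive_zre_x, Derive_bessel, Derive_bessel'.
    replace (x * (x * 1) + y * (y * 1)) with (x ^ 2 + y ^ 2) by ring. ring. }
assert (Eyy : partial false (fun x y =>
  c * (- INR k * zim (pred k) x y * bessel k (lam * (x ^ 2 + y ^ 2))
       + 2 * lam * y * zre k x y * bessel' k (lam * (x ^ 2 + y ^ 2)))) x y =
  c * (- INR k * INR (pred k) * zre (pred (pred k)) x y * bessel k (lam * (x ^ 2 + y ^ 2))
       + (- 4 * lam * INR k * y * zim (pred k) x y + 2 * lam * zre k x y)
         * bessel' k (lam * (x ^ 2 + y ^ 2))
       + 4 * lam ^ 2 * y ^ 2 * zre k x y * bessel'' k (lam * (x ^ 2 + y ^ 2)))).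
{ unfold partial. apply is_derive_unique. auto_derive.
  - ex_derives.
  - rewrite Derive_zre_y, Derive_zim_y, Derive_bessel, Derive_bessel'.
    replace (x * (x * 1) + y * (y * 1)) with (x ^ 2 + y ^ 2) by ring. ring. }
rewrite Exx, Eyy. unfold mode.
assert (Heuler : INR k * (x * zre (pred k) x y - y * zim (pred k) x y) = INR k * zre k x y)
  by (destruct k; [simpl; ring | rewrite zre_S; reflexivity]).
assert (Hode := bessel_ode k (lam * (x ^ 2 + y ^ 2))).
set (F := bessel k (lam * (x ^ 2 + y ^ 2))) in *.
set (F' := bessel' k (lam * (x ^ 2 + y ^ 2))) in *.
set (F'' := bessel'' k (lam * (x ^ 2 + y ^ 2))) in *.
transitivity (- (4 * lam * c * (INR k * (x * zre (pred k) x y - y * zim (pred k) x y) * F'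
  + zre k x y * (F' + lam * (x ^ 2 + y ^ 2) * F'')))); [ring|].
rewrite Heuler.
replace (lam * (x ^ 2 + y ^ 2) * F'') with (- (INR k + 1) * F' - F / 4) by lra. field.
Qed.

(** A syntactic class closed under partial derivatives, so that one induction on the word [w]
    handles all iterated partials. The last constructor asks for entire series because
    differentiating one gives another. *)
Inductive smooth_class : (R -> R -> R) -> Prop :=
| smooth_const c : smooth_class (fun _ _ => c)
| smooth_fst : smooth_class (fun x _ => x)
| smooth_snd : smooth_class (fun _ y => y)
| smooth_plus f g : smooth_class f -> smooth_class g -> smooth_class (fun x y => f x y + g x y)
| smooth_mult f g : smooth_class f -> smooth_class g -> smooth_class (fun x y => f x y * g x y)
| smooth_entire a f : CV_radius a = p_infty -> smooth_class f ->
    smooth_class (fun x y => PSeries a (f x y)).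

Definition is_partial (b : bool) (f : R -> R -> R) (x y d : R) : Prop :=
  if b then is_derive (fun t => f t y) x d else is_derive (fun t => f x t) y d.

Lemma smooth_class_partial (b : bool) (f : R -> R -> R) : smooth_class f ->
  exists g, smooth_class g /\ forall x y, is_partial b f x y (g x y).
Proof.
induction 1 as [c | | | f g Hf [f1 [Hf1 Df]] Hg [g1 [Hg1 Dg]]
  | f g Hf [f1 [Hf1 Df]] Hg [g1 [Hg1 Dg]] | a f Ha Hf [f1 [Hf1 Df]]].
- exists (fun _ _ => 0). split; [constructor|].
  intros x y; unfold is_partial in *; destruct b; apply (is_derive_const (V := R_NormedModule)).
- exists (fun _ _ => if b then 1 else 0). split; [constructor|].
  intros x y; unfold is_partial; destruct b;
    [apply (is_derive_id (K := R_AbsRing)) | apply (is_derive_const (V := R_NormedModule))].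
- exists (fun _ _ => if b then 0 else 1). split; [constructor|].
  intros x y; unfold is_partial; destruct b;
    [apply (is_derive_const (V := R_NormedModule)) | apply (is_derive_id (K := R_AbsRing))].
- exists (fun x y => f1 x y + g1 x y). split; [now constructor|].
  intros x y; unfold is_partial in *; destruct b;
    apply (is_derive_plus (V := R_NormedModule)); auto.
- exists (fun x y => f1 x y * g x y + f x y * g1 x y).
  split; [constructor; now constructor|].
  intros x y; unfold is_partial in *; destruct b;
    [ apply (is_derive_mult (fun t => f t y) (fun t => g t y))
    | apply (is_derive_mult (f x) (g x)) ]; auto; intros; apply Rmult_comm.
- exists (fun x y => f1 x y * PSeries (PS_derive a) (f x y)).
  split; [constructor; [easy | constructor; [now apply entire_PS_derive | easy]]|].
  intros x y; unfold is_partial in *; destruct b;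
    [ apply (is_derive_comp (V := R_NormedModule) (PSeries a) (fun t => f t y))
    | apply (is_derive_comp (V := R_NormedModule) (PSeries a) (f x)) ];
    auto; now apply entire_is_derive.
Qed.

Lemma smooth_class_continuous (f : R -> R -> R) (x y : R) : smooth_class f ->
  continuous (fun p : R * R => f (fst p) (snd p)) (x, y).
Proof.
induction 1 as [c | | | f g Hf Cf Hg Cg | f g Hf Cf Hg Cg | a f Ha Hf Cf].
- apply continuous_const.
- apply continuous_fst.
- apply continuous_snd.
- now apply (continuous_plus (V := R_NormedModule)).
- now apply (continuous_mult (K := R_AbsRing)).
- apply (continuous_comp (fun p : R * R => f (fst p) (snd p)) (PSeries a)); [easy|].
  now apply entire_continuous.
Qed.

Lemma smooth_class_iter_partial (w : list bool) (f : R -> R -> R) :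
  smooth_class f -> smooth_class (iter_partial w f).
Proof.
intros Hf. induction w as [|b w IH]; [easy|]. cbn [iter_partial].
destruct (smooth_class_partial b _ IH) as [g [Hg Dg]].
replace (partial b (iter_partial w f)) with g; [easy|].
apply functional_extensionality; intros x. apply functional_extensionality; intros y.
specialize (Dg x y). symmetry. destruct b; now apply is_derive_unique.
Qed.

Lemma smooth_class_smooth (f : R -> R -> R) : smooth_class f -> smooth_closed_disk f.
Proof.
intros Hf. exists 1. split; [lra|]. intros w x y _.
assert (Hw := smooth_class_iter_partial w f Hf). split.
- intros b. destruct (smooth_class_partial b _ Hw) as [g [_ Dg]]. specialize (Dg x y).
  destruct b; eexists; exact Dg.
- now apply smooth_class_continuous.
Qed.

Lemma zre_zim_smooth (k : nat) : smooth_class (zre k) /\ smooth_class (zim k).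
Proof.
induction k as [|k [IHre IHim]].
- split; [apply (smooth_const 1) | apply (smooth_const 0)].
- split.
  + replace (zre (S k)) with (fun x y => x * zre k x y + (-1 * y) * zim k x y).
    * constructor; constructor; try easy; constructor; constructor.
    * apply functional_extensionality; intros x. apply functional_extensionality; intros y.
      rewrite zre_S. ring.
  + apply (smooth_plus (fun x y => x * zim k x y) (fun x y => y * zre k x y));
      constructor; trivial; constructor.
Qed.

Lemma mode_smooth (k : nat) (lam c : R) : smooth_class (mode k lam c).
Proof.
unfold mode. constructor; [constructor|]. constructor; [apply zre_zim_smooth|].
apply (smooth_entire (bessel_coef k) (fun x y => lam * (x ^ 2 + y ^ 2)));
  [apply bessel_coef_entire|].
repeat constructor.
Qed.

(** * Integration over the disk *)

Lemma continuous_section (g : R -> R -> R) (x y : R) :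
  (forall x y, continuous (fun p : R * R => g (fst p) (snd p)) (x, y)) ->
  continuous (g x) y.
Proof.
intros Hg. apply (continuous_comp_2 (fun _ => x) (fun t => t) g);
  [apply continuous_const | apply continuous_id | apply Hg].
Qed.

Lemma ex_RInt_section (g : R -> R -> R) (x a b : R) :
  (forall x y, continuous (fun p : R * R => g (fst p) (snd p)) (x, y)) ->
  ex_RInt (g x) a b.
Proof.
intros Hg. apply (ex_RInt_continuous (V := R_CompleteNormedModule)). intros z _.
now apply continuous_section.
Qed.

Lemma continuous_RInt_param (g : R -> R -> R) (x : R) :
  (forall x y, continuous (fun p : R * R => g (fst p) (snd p)) (x, y)) ->
  continuous (fun x => RInt (g x) (-1) 1) x.
Proof.
intros Hg. apply continuity_pt_filterlim. intros eps Heps.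
assert (Heps4 : 0 < eps / 4) by lra.
destruct (uniform_continuity_2d_1d' g (-1) 1 x) with (mkposreal _ Heps4) as [d Hd].
{ intros y _. apply continuity_2d_pt_filterlim, Hg. }
exists d. split; [apply cond_pos|]. intros x' [_ Hx']. simpl in Hx' |- *. unfold R_dist in *.
apply Rabs_def2 in Hx'. assert (Hd0 := cond_pos d). simpl in Hd.
replace (RInt (g x') (-1) 1 - RInt (g x) (-1) 1)
  with (RInt (fun y => minus (g x' y) (g x y)) (-1) 1)
  by (apply (RInt_minus (V := R_CompleteNormedModule) (g x') (g x)); now apply ex_RInt_section).
apply Rle_lt_trans with ((1 - -1) * (eps / 4)); [|lra].
apply abs_RInt_le_const; [lra| |].
- apply (ex_RInt_minus (V := R_NormedModule)); now apply ex_RInt_section.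
- intros t Ht. left. apply (Hd t x t x'); try lra. rewrite Rminus_diag, Rabs_R0. exact Hd0.
Qed.

Lemma RInt_ge_const (f : R -> R) (c d a b m : R) : c <= a -> a <= b -> b <= d ->
  (forall x, continuous f x) -> (forall x, 0 <= f x) -> (forall x, a < x < b -> m <= f x) ->
  m * (b - a) <= RInt f c d.
Proof.
intros Hca Hab Hbd Hf Hf0 Hm.
assert (Hex : forall u v, ex_RInt f u v).
{ intros u v. apply (ex_RInt_continuous (V := R_CompleteNormedModule)). intros; apply Hf. }
assert (H1 : RInt f c d = RInt f c a + (RInt f a b + RInt f b d)).
{ rewrite <- (RInt_Chasles f c a d), <- (RInt_Chasles f a b d) by apply Hex. reflexivity. }
assert (H2 : 0 <= RInt f c a) by (apply RInt_ge_0; auto).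
assert (H3 : 0 <= RInt f b d) by (apply RInt_ge_0; auto).
assert (H4 : RInt (fun _ => m) a b <= RInt f a b).
{ apply RInt_le; auto. apply (ex_RInt_const (V := R_NormedModule)). }
rewrite RInt_const in H4. unfold scal in H4; simpl in H4. unfold mult in H4; simpl in H4. lra.
Qed.

Definition disk_section (g : R -> R -> R) (x : R) : R :=
  RInt (g x) (- sqrt (1 - x ^ 2)) (sqrt (1 - x ^ 2)).

(** The substitution y = w(x) s moves the integral to the fixed interval [-1, 1], so the variable
    endpoints enter only through the continuous function w. For |x| > 1 the default [sqrt] of a
    negative number, 0, keeps w continuous on the whole line. *)
Lemma continuous_disk_section (g : R -> R -> R) (x : R) :
  (forall x y, continuous (fun p : R * R => g (fst p) (snd p)) (x, y)) ->
  continuous (disk_section g) x.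
Proof.
intros Hg. set (w := fun x => sqrt (1 - x ^ 2)).
assert (Hw : forall x, continuous w x).
{ intros u. apply continuous_sqrt_comp. apply (ex_derive_continuous (V := R_NormedModule)).
  auto_derive. trivial. }
apply (continuous_ext (fun x => w x * RInt (fun s => g x (w x * s)) (-1) 1)).
{ intros u. unfold disk_section. fold (w u).
  rewrite <- (RInt_scal (V := R_CompleteNormedModule)).
  - assert (H := RInt_comp_lin (g u) (w u) 0 (-1) 1).
    replace (w u * -1 + 0) with (- w u) in H by ring.
    replace (w u * 1 + 0) with (w u) in H by ring.
    rewrite <- H by now apply ex_RInt_section.
    apply RInt_ext. intros s _. now rewrite Rplus_0_r.
  - apply (ex_RInt_continuous (V := R_CompleteNormedModule)). intros s _.
    apply (continuous_comp (fun s => w u * s) (g u)); [|now apply continuous_section].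
    apply (ex_derive_continuous (V := R_NormedModule)). auto_derive. trivial. }
apply (continuous_mult (K := R_AbsRing)); [apply Hw|].
apply (continuous_RInt_param (fun x s => g x (w x * s))). clear x. intros u s.
apply (continuous_comp_2 (fun p : R * R => fst p) (fun p : R * R => w (fst p) * snd p) g);
  [apply continuous_fst | | apply Hg].
apply (continuous_mult (K := R_AbsRing)); [|apply continuous_snd].
apply (continuous_comp fst w); [apply continuous_fst | apply Hw].
Qed.

Lemma continuous_sqr_2 (f : R -> R -> R) :
  (forall x y, continuous (fun p : R * R => f (fst p) (snd p)) (x, y)) ->
  forall x y, continuous (fun p : R * R => f (fst p) (snd p) ^ 2) (x, y).
Proof.
intros Hf x y. apply (continuous_comp (fun p : R * R => f (fst p) (snd p)) (fun z => z ^ 2)).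
- apply Hf.
- apply (ex_derive_continuous (V := R_NormedModule)). auto_derive. trivial.
Qed.

Lemma L2sq_disk_ge (f : R -> R -> R) (a b h m : R) :
  (forall x y, continuous (fun p : R * R => f (fst p) (snd p)) (x, y)) ->
  0 <= a -> a <= b -> 0 <= h -> 0 <= m -> b ^ 2 + h ^ 2 <= 1 ->
  (forall x y, a < x < b -> Rabs y < h -> m <= f x y) ->
  m ^ 2 * (2 * h) * (b - a) <= L2sq_disk f.
Proof.
intros Hf Ha Hab Hh Hm Hbh Hmf.
set (g := fun x y => f x y ^ 2).
assert (Hg : forall x y, continuous (fun p : R * R => g (fst p) (snd p)) (x, y))
  by now apply continuous_sqr_2.
assert (Hsec : forall x, 0 <= disk_section g x).
{ intros x. assert (H := sqrt_pos (1 - x ^ 2)). apply RInt_ge_0; [lra| |].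
  - now apply ex_RInt_section.
  - intros y _. apply pow2_ge_0. }
apply (RInt_ge_const (disk_section g)); try easy; try nra.
- intros x. now apply continuous_disk_section.
- intros x Hx. assert (Hw : h <= sqrt (1 - x ^ 2)).
  { rewrite <- (sqrt_pow2 h) by easy. apply sqrt_le_1_alt. nra. }
  replace (m ^ 2 * (2 * h)) with (m ^ 2 * (h - - h)) by ring.
  apply RInt_ge_const; try lra.
  + intros y. now apply continuous_section.
  + intros y. apply pow2_ge_0.
  + intros y Hy. unfold g. specialize (Hmf x y Hx ltac:(now apply Rabs_def1)). nra.
Qed.

Lemma L2sq_disk_scal (c : R) (f : R -> R -> R) :
  (forall x y, continuous (fun p : R * R => f (fst p) (snd p)) (x, y)) ->
  L2sq_disk (fun x y => c * f x y) = c ^ 2 * L2sq_disk f.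
Proof.
intros Hf. set (g := fun x y => f x y ^ 2).
assert (Hg : forall x y, continuous (fun p : R * R => g (fst p) (snd p)) (x, y))
  by now apply continuous_sqr_2.
transitivity (RInt (fun x => scal (c ^ 2) (disk_section g x)) (-1) 1).
- apply RInt_ext. intros x _. unfold disk_section.
  rewrite <- (RInt_scal (V := R_CompleteNormedModule)) by now apply ex_RInt_section.
  apply RInt_ext. intros y _. unfold scal, g; simpl. unfold mult; simpl. ring.
- apply (RInt_scal (V := R_CompleteNormedModule)).
  apply (ex_RInt_continuous (V := R_CompleteNormedModule)). intros x _.
  now apply continuous_disk_section.
Qed.

(** * The Agmon distance and the pointwise decay of the mode *)

(** With q = sqrt(1 - r^2), exp(alpha) = (1 + q) / r and exp(-alpha) = (1 - q) / r, hence
    tanh(alpha) = q. *)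
Lemma dA_closed_form (r : R) : 0 < r <= 1 ->
  dA r = ln (1 + sqrt (1 - r ^ 2)) - ln r - sqrt (1 - r ^ 2).
Proof.
intros Hr. assert (Hq0 := sqrt_pos (1 - r ^ 2)).
assert (Hq2 : sqrt (1 - r ^ 2) ^ 2 = 1 - r ^ 2) by (apply pow2_sqrt; nra).
set (q := sqrt (1 - r ^ 2)) in *.
assert (Ha : alphaA r = ln ((1 + q) / r)).
{ unfold alphaA, arcosh. f_equal.
  replace (sqrt (/ r * / r - 1)) with (q / r); [field; lra|].
  rewrite <- (sqrt_pow2 (q / r)) by (apply Rdiv_le_0_compat; lra). f_equal.
  unfold Rdiv. rewrite Rpow_mult_distr, Hq2. field. lra. }
unfold dA. rewrite Ha.
assert (Hv : 0 < (1 + q) / r) by (apply Rdiv_lt_0_compat; lra).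
assert (Ht : tanh (ln ((1 + q) / r)) = q).
{ unfold tanh, sinh, cosh. rewrite exp_Ropp, exp_ln by easy.
  assert (Hinv : / ((1 + q) / r) = (1 - q) / r).
  { apply Rmult_eq_reg_l with ((1 + q) / r); [|lra]. rewrite Rinv_r by lra.
    replace ((1 + q) / r * ((1 - q) / r)) with ((1 - q ^ 2) / r ^ 2) by (field; lra).
    rewrite Hq2. field. lra. }
  rewrite Hinv. field. lra. }
rewrite Ht, ln_div by lra. ring.
Qed.

Lemma ln_1p_minus_decr (p q : R) : 0 <= p <= q -> ln (1 + q) - q <= ln (1 + p) - p.
Proof.
intros Hpq. enough (p - ln (1 + p) <= q - ln (1 + q)) by lra.
apply (le_of_derive_nonneg (fun x => x - ln (1 + x)) (fun x => x / (1 + x))); [lra| |].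
- intros x Hx. auto_derive; [lra|]. field. lra.
- intros x Hx. apply Rdiv_le_0_compat; lra.
Qed.

(** From r^2 = (1 - q)(1 + q), twice dA is ln(1 + q) - ln(1 - q) - 2 q, which increases from 0. The
    sign is what later allows k to be replaced by the smaller j - C nu in front of dA. *)
Lemma dA_nonneg (r : R) : 0 < r <= 1 -> 0 <= dA r.
Proof.
intros Hr. rewrite dA_closed_form by easy.
assert (Hq0 := sqrt_pos (1 - r ^ 2)).
assert (Hq2 : sqrt (1 - r ^ 2) ^ 2 = 1 - r ^ 2) by (apply pow2_sqrt; nra).
set (q := sqrt (1 - r ^ 2)) in *. assert (Hq : q < 1) by nra.
assert (Hr2 : 2 * ln r = ln (1 - q) + ln (1 + q)).
{ rewrite <- ln_mult by lra. replace ((1 - q) * (1 + q)) with (r * r) by lra.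
  rewrite ln_mult by lra. ring. }
assert (H : ln (1 + 0) - ln (1 - 0) - 2 * 0 <= ln (1 + q) - ln (1 - q) - 2 * q).
{ apply (le_of_derive_nonneg (fun x => ln (1 + x) - ln (1 - x) - 2 * x)
    (fun x => 2 * x ^ 2 / (1 - x ^ 2))); [lra| |].
  - intros x Hx. auto_derive; [lra|]. field. nra.
  - intros x Hx. apply Rdiv_le_0_compat; nra. }
rewrite Rplus_0_r, Rminus_0_r, ln_1 in H. lra.
Qed.

Lemma mode_decay (k : nat) (j r x y : R) : (1 <= k)%nat -> INR k <= j ->
  0 < r -> j * r <= INR k -> x ^ 2 + y ^ 2 <= r ^ 2 ->
  Rabs (zre k x y * bessel k (j ^ 2 * (x ^ 2 + y ^ 2)))
    <= bessel k (INR k ^ 2) * exp (- INR k * dA r).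
Proof.
intros Hk Hj Hr Hjr Hxy. assert (HK : 1 <= INR k) by (apply (le_INR 1); easy).
assert (Hr1 : r <= 1) by nra.
set (s := x ^ 2 + y ^ 2) in *. assert (Hs : 0 <= s) by (unfold s; nra).
assert (Hj2 : 0 < j ^ 2) by nra.
assert (Hjr2 : j ^ 2 * r ^ 2 <= INR k ^ 2).
{ replace (j ^ 2 * r ^ 2) with ((j * r) ^ 2) by ring. apply pow_incr. nra. }
assert (HFr : 0 < bessel k (j ^ 2 * r ^ 2)) by (apply bessel_pos; [easy|nra]).
assert (Hrk : 0 < r ^ k) by now apply pow_lt.
apply Rle_trans with (r ^ k * bessel k (j ^ 2 * r ^ 2)).
(* Squared, the mode is at most s^k F(j^2 s)^2, which is nondecreasing in s up to the turning
   point. *)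
{ rewrite <- (Rabs_pos_eq (r ^ k * _)) by nra. apply Rsqr_le_abs_0. unfold Rsqr.
  assert (H := bessel_sqr_incr k (j ^ 2 * s) (j ^ 2 * r ^ 2) Hk ltac:(nra) Hjr2).
  rewrite !Rpow_mult_distr, <- (pow_mult r), (Nat.mul_comm 2), pow_mult in H.
  assert (Hz := zre_zim_sqr k x y). fold s in Hz.
  assert (Hzs : zre k x y ^ 2 <= s ^ k) by nra.
  assert (Hjk : 0 < (j ^ 2) ^ k) by now apply pow_lt.
  assert (HF2 := pow2_ge_0 (bessel k (j ^ 2 * s))).
  apply Rmult_le_reg_l with (1 := Hjk).
  apply Rle_trans with ((j ^ 2) ^ k * s ^ k * bessel k (j ^ 2 * s) ^ 2); [|lra].
  apply Rle_trans with ((j ^ 2) ^ k * (zre k x y ^ 2 * bessel k (j ^ 2 * s) ^ 2)); [right; ring|].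
  rewrite Rmult_assoc. apply Rmult_le_compat_l; [lra|]. now apply Rmult_le_compat_r. }
(* p is the decay parameter of the radius j r / k, relative to the turning point. As j r / k >= r,
   it is at most the parameter q of r, and ln(1 + x) - x is decreasing. *)
set (p := sqrt (1 - (j * r / INR k) ^ 2)).
assert (Hjrk : 0 < j * r / INR k <= 1).
{ split; [apply Rdiv_lt_0_compat; nra|]. apply Rle_div_l; lra. }
assert (Hrle : r <= j * r / INR k) by (apply Rle_div_r; nra).
assert (Hp0 : 0 <= p) by apply sqrt_pos.
assert (Hp2 : p ^ 2 = 1 - (j * r / INR k) ^ 2) by (apply pow2_sqrt; nra).
assert (Hpq : p <= sqrt (1 - r ^ 2)) by (apply sqrt_le_1_alt; nra).
assert (Hdec := bessel_decay k p Hk ltac:(nra)).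
replace (INR k ^ 2 * (1 - p ^ 2)) with (j ^ 2 * r ^ 2) in Hdec by (rewrite Hp2; field; lra).
rewrite dA_closed_form by lra.
assert (Hln := ln_1p_minus_decr p (sqrt (1 - r ^ 2)) ltac:(lra)).
set (q := sqrt (1 - r ^ 2)) in *.
replace (- INR k * (ln (1 + q) - ln r - q)) with (INR k * ln r + - INR k * (ln (1 + q) - q))
  by ring.
rewrite exp_plus. replace (exp (INR k * ln r)) with (r ^ k)
  by (rewrite <- Rpower_pow by easy; reflexivity).
apply Rle_trans with (r ^ k * (bessel k (INR k ^ 2) * exp (- INR k * (ln (1 + p) - p)))).
{ apply Rmult_le_compat_l; lra. }
assert (HFk : 0 < bessel k (INR k ^ 2)) by (apply bessel_pos; [easy|nra]).
assert (He : exp (- INR k * (ln (1 + p) - p)) <= exp (- INR k * (ln (1 + q) - q))).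
{ apply exp_le. nra. }
replace (bessel k (INR k ^ 2) * (r ^ k * exp (- INR k * (ln (1 + q) - q))))
  with (r ^ k * (bessel k (INR k ^ 2) * exp (- INR k * (ln (1 + q) - q)))) by ring.
apply Rmult_le_compat_l; [lra|]. apply Rmult_le_compat_l; lra.
Qed.

(** * Lower bound for the norm of the unnormalized mode *)

Lemma mode_continuous (k : nat) (lam c x y : R) :
  continuous (fun p : R * R => mode k lam c (fst p) (snd p)) (x, y).
Proof. apply smooth_class_continuous, mode_smooth. Qed.

Lemma L2sq_mode_ge (k : nat) (j : R) : (1 <= k)%nat -> INR k <= j ->
  (((INR k - 1 / 2) / j) ^ k) ^ 3 * bessel k (INR k ^ 2) ^ 2 / (16 * j * INR k)
    <= L2sq_disk (mode k (j ^ 2) 1).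
Proof.
intros Hk Hj. assert (HK : 1 <= INR k) by (apply (le_INR 1); easy).
(* The box a < x < b, |y| < h lies inside radius k / j, where F is at least F(k^2). The height h
   makes k |y| at most a^k / 2, so [zre_ge] leaves at least a^k / 2; squaring this and multiplying
   by the area gives the cube of a^k. *)
set (a := (INR k - 1 / 2) / j). set (b := (INR k - 1 / 4) / j).
set (h := a ^ k / (2 * INR k)).
assert (HFk : 0 < bessel k (INR k ^ 2)) by (apply bessel_pos; [easy|nra]).
assert (Ha : 0 < a < 1).
{ split; [apply Rdiv_lt_0_compat; lra|]. apply Rlt_div_l; lra. }
assert (Hb : 0 < b) by (apply Rdiv_lt_0_compat; lra).
assert (Hab : b - a = / (4 * j)) by (unfold a, b; field; lra).
assert (Hij : 0 < / (4 * j)) by (apply Rinv_0_lt_compat; lra).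
assert (Hak : 0 < a ^ k <= a).
{ split; [apply pow_lt; lra|]. destruct k as [|n]; [lia|]. rewrite <- tech_pow_Rmult.
  assert (a ^ n <= 1) by (rewrite <- (pow1 n); apply pow_incr; lra). nra. }
assert (Hh : 0 < h /\ j * h <= 1 / 2).
{ split; [apply Rdiv_lt_0_compat; lra|]. unfold h.
  apply Rle_trans with (j * (a / (2 * INR k))).
  - apply Rmult_le_compat_l; [lra|]. apply Rmult_le_compat_r; [|lra].
    left. apply Rinv_0_lt_compat. lra.
  - replace (j * (a / (2 * INR k))) with ((INR k - 1 / 2) / (2 * INR k)) by (unfold a; field; lra).
    apply Rle_div_l; lra. }
assert (Hbox : j ^ 2 * (b ^ 2 + h ^ 2) <= INR k ^ 2).
{ replace (j ^ 2 * (b ^ 2 + h ^ 2)) with ((INR k - 1 / 4) ^ 2 + (j * h) ^ 2)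
    by (unfold b; field; lra).
  assert (0 <= j * h) by (apply Rmult_le_pos; lra).
  assert ((j * h) ^ 2 <= (1 / 2) ^ 2) by (apply pow_incr; lra). lra. }
assert (Hbh1 : b ^ 2 + h ^ 2 <= 1).
{ assert (INR k ^ 2 <= j ^ 2) by (apply pow_incr; lra). apply Rmult_le_reg_l with (j ^ 2); nra. }
apply Rle_trans with ((a ^ k / 2 * bessel k (INR k ^ 2)) ^ 2 * (2 * h) * (b - a)).
{ right. rewrite Hab. unfold h. field. lra. }
apply L2sq_disk_ge; try lra.
- intros x y. apply mode_continuous.
- nra.
- intros x y Hx Hy. unfold mode. rewrite Rmult_1_l.
  assert (Hy2 : y ^ 2 <= h ^ 2).
  { rewrite <- (pow2_abs y). apply pow_incr. split; [apply Rabs_pos | lra]. }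
  assert (Hxy : x ^ 2 + y ^ 2 <= b ^ 2 + h ^ 2) by nra.
  assert (Hxa : a ^ k <= x ^ k) by (apply pow_incr; lra).
  assert (Hz := zre_ge k x y ltac:(lra)).
  assert (Hky : INR k * Rabs y <= a ^ k / 2).
  { apply Rle_trans with (INR k * h); [apply Rmult_le_compat_l; lra|].
    right. unfold h. field. lra. }
  apply Rmult_le_compat; [lra | lra | lra |].
  apply bessel_decr; [easy | | lra]. nra.
Qed.

Lemma exp_mult_INR (n : nat) (x : R) : exp (INR n * x) = exp x ^ n.
Proof.
induction n as [|n IH]; [simpl; now rewrite Rmult_0_l, exp_0|].
rewrite S_INR, Rmult_plus_distr_r, exp_plus, IH, Rmult_1_l. simpl. ring.
Qed.

(** j / (k - 1/2) is 1 + u with u = (2(j - k) + 1) / (2k - 1), and 1 + u <= e^u with 2k - 1 >= k. *)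
Lemma box_pow_ge (k : nat) (j : R) : (1 <= k)%nat -> INR k <= j ->
  exp (- (2 * (j - INR k) + 1)) <= ((INR k - 1 / 2) / j) ^ k.
Proof.
intros Hk Hj. assert (HK : 1 <= INR k) by (apply (le_INR 1); easy).
replace (- (2 * (j - INR k) + 1)) with (INR k * (- ((2 * (j - INR k) + 1) / INR k)))
  by (field; lra).
rewrite exp_mult_INR. apply pow_incr. split; [left; apply exp_pos|].
rewrite exp_Ropp.
replace ((INR k - 1 / 2) / j) with (/ (1 + (j - INR k + 1 / 2) / (INR k - 1 / 2)))
  by (field; lra).
assert (H0 : 0 <= (j - INR k + 1 / 2) / (INR k - 1 / 2)) by (apply Rdiv_le_0_compat; lra).
apply Rinv_le_contravar; [lra|].
apply Rle_trans with (1 := exp_ineq1_le _). apply exp_le.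
apply Rle_div_l; [lra|]. unfold Rdiv. rewrite Rmult_assoc, (Rmult_comm (/ INR k)), <- Rmult_assoc.
apply Rle_div_r; nra.
Qed.

Lemma normalized_peak_le (k : nat) (j nu c0 : R) : (1 <= k)%nat -> INR k <= j ->
  0 < nu -> nu ^ 3 = j -> j - INR k <= c0 * nu ->
  0 < L2sq_disk (mode k (j ^ 2) 1) /\
  / sqrt (L2sq_disk (mode k (j ^ 2) 1)) * bessel k (INR k ^ 2) <= exp ((13 + 3 * c0) * nu).
Proof.
intros Hk Hj Hnu Hnuj Hjk. assert (HK : 1 <= INR k) by (apply (le_INR 1); easy).
assert (Hge := L2sq_mode_ge k j Hk Hj). assert (Hbox := box_pow_ge k j Hk Hj).
set (A := ((INR k - 1 / 2) / j) ^ k) in *. set (F := bessel k (INR k ^ 2)) in *.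
set (L := L2sq_disk (mode k (j ^ 2) 1)) in *.
assert (HF : 0 < F) by (apply bessel_pos; [easy|nra]).
assert (HA : 0 < A) by (apply Rlt_le_trans with (2 := Hbox); apply exp_pos).
assert (HA3 : 0 < A ^ 3) by now apply pow_lt.
assert (Hjk16 : 0 < 16 * j * INR k) by nra.
assert (HL : 0 < L).
{ apply Rlt_le_trans with (2 := Hge). apply Rdiv_lt_0_compat; [|easy].
  apply Rmult_lt_0_compat; [easy | now apply pow_lt]. }
split; [easy|].
assert (Hnu1 : 1 <= nu) by (apply Rnot_lt_le; intros Hlt; nra).
(* E^2 must outweigh 16 j k <= exp(22 nu) and the inverse of A^3, at most exp((6 c0 + 3) nu); 26 + 6
   c0 covers the sum of these exponents. *)
set (E := exp ((13 + 3 * c0) * nu)). assert (HE : 0 < E) by apply exp_pos.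
assert (HA3e : exp (- (6 * c0 + 3) * nu) <= A ^ 3).
{ apply Rle_trans with (exp (- (2 * (j - INR k) + 1)) ^ 3).
  - rewrite <- exp_mult_INR. apply exp_le. simpl. nra.
  - apply pow_incr. split; [left; apply exp_pos | easy]. }
assert (H16 : 16 * j * INR k <= exp (22 * nu)).
{ apply Rle_trans with (16 * nu ^ 6).
  - replace (nu ^ 6) with (nu ^ 3 * nu ^ 3) by ring. rewrite Hnuj. nra.
  - replace (22 * nu) with (16 * nu + 6 * nu) by ring. rewrite exp_plus.
    assert (Hn := exp_ineq1_le nu). assert (H16 := exp_ineq1_le (16 * nu)).
    apply Rmult_le_compat; [lra | apply pow_le; lra | lra |].
    replace (6 * nu) with (INR 6 * nu) by (simpl; ring). rewrite exp_mult_INR.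
    apply pow_incr. lra. }
assert (HF2 : F ^ 2 <= L * E ^ 2).
{ assert (HE2 : exp (22 * nu) <= A ^ 3 * E ^ 2).
  { apply Rle_trans with (exp (- (6 * c0 + 3) * nu) * E ^ 2).
    - unfold E. rewrite <- exp_mult_INR, <- exp_plus. apply exp_le. simpl. nra.
    - apply Rmult_le_compat_r; [apply pow2_ge_0 | easy]. }
  apply Rmult_le_reg_l with (16 * j * INR k); [easy|].
  assert (H1 : A ^ 3 * F ^ 2 <= L * (16 * j * INR k)).
  { apply Rle_div_l in Hge; lra. }
  apply Rle_trans with (A ^ 3 * E ^ 2 * F ^ 2).
  - apply Rmult_le_compat_r; [apply pow2_ge_0 | lra].
  - assert (HEE := pow2_ge_0 E). nra. }
assert (HsL : 0 < sqrt L) by now apply sqrt_lt_R0.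
rewrite Rmult_comm. apply Rle_div_l; [easy|].
apply Rsqr_incr_0_var; [|nra]. unfold Rsqr.
replace (E * sqrt L * (E * sqrt L)) with (sqrt L ^ 2 * E ^ 2) by ring.
rewrite pow2_sqrt by lra. lra.
Qed.

(** * Assembly of the eigenmodes *)

Lemma cube_root_pow (x : R) : 0 < x -> Rpower x (1 / 3) ^ 3 = x.
Proof.
intros Hx. rewrite <- Rpower_pow by apply exp_pos. rewrite Rpower_mult.
replace (1 / 3 * INR 3) with 1 by (simpl; field). now apply Rpower_1.
Qed.

(** Membership in H^1_0 is expressed by zero boundary values, which is equivalent for functions
    smooth up to the boundary. *)
Definition dirichlet_eigenmode (psi : R -> R -> R) (lam : R) : Prop :=
  smooth_closed_disk psi /\
  (forall x y, x ^ 2 + y ^ 2 = 1 -> psi x y = 0) /\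
  0 <= lam /\
  L2sq_disk psi = 1 /\
  (forall x y, x ^ 2 + y ^ 2 < 1 -> - laplacian psi x y = lam * psi x y).

Definition inner_decay (C beta : R) (psi : R -> R -> R) (lam : R) : Prop :=
  forall r : R, 0 < r -> r <= 1 - beta * Rpower lam (- (1 / 3)) ->
  forall x y : R, x ^ 2 + y ^ 2 < r ^ 2 ->
    Rabs (psi x y) <= exp (- (sqrt lam - C * Rpower lam (1 / 6)) * dA r + C * Rpower lam (1 / 6)).

Definition zero_gap : R := 5 * exp 5.

Lemma eigenmode_exists (k : nat) : (1 <= k)%nat -> exists psi lam,
  dirichlet_eigenmode psi lam /\
  Rabs (lam - INR k ^ 2) <= zero_gap * (2 + zero_gap) * Rpower (INR k) (4 / 3) /\
  inner_decay (13 + 4 * zero_gap) zero_gap psi lam.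
Proof.
intros Hk. assert (HK : 1 <= INR k) by (apply (le_INR 1); easy).
assert (Hc : 0 < zero_gap) by (unfold zero_gap; assert (H := exp_pos 5); lra).
set (mu := Rpower (INR k) (1 / 3)).
assert (Hmu : 0 < mu) by apply exp_pos.
assert (Hmu3 : mu ^ 3 = INR k) by (apply cube_root_pow; lra).
destruct (bessel_zero_near k mu Hk Hmu Hmu3) as [j [Hj Fj]]. fold zero_gap in Hj.
set (nu := Rpower j (1 / 3)).
assert (Hnu : 0 < nu) by apply exp_pos.
assert (Hnu3 : nu ^ 3 = j) by (apply cube_root_pow; lra).
assert (Hmunu : mu <= nu) by (apply Rle_Rpower_l; lra).
destruct (normalized_peak_le k j nu zero_gap Hk ltac:(lra) Hnu Hnu3 ltac:(nra)) as [HL HN].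
set (N := / sqrt (L2sq_disk (mode k (j ^ 2) 1))) in *.
assert (HsL : 0 < sqrt (L2sq_disk (mode k (j ^ 2) 1))) by now apply sqrt_lt_R0.
assert (HN0 : 0 < N) by now apply Rinv_0_lt_compat.
exists (mode k (j ^ 2) N), (j ^ 2). split; [|split].
- split; [|split; [|split; [|split]]].
  + apply smooth_class_smooth, mode_smooth.
  + intros x y Hxy. unfold mode. rewrite Hxy, Rmult_1_r, Fj. ring.
  + apply pow2_ge_0.
  + replace (mode k (j ^ 2) N) with (fun x y => N * mode k (j ^ 2) 1 x y).
    * rewrite L2sq_disk_scal by apply mode_continuous.
      unfold N. rewrite <- (pow2_sqrt (L2sq_disk (mode k (j ^ 2) 1))) at 2 by lra.
      field. lra.
    * apply functional_extensionality; intros x. apply functional_extensionality; intros y.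
      unfold mode. ring.
  + intros x y _. apply laplacian_mode.
- replace (Rpower (INR k) (4 / 3)) with (INR k * mu).
  + assert (Hmu1 : 1 <= mu) by (apply Rnot_lt_le; intros Hlt; nra).
    assert (Hmk : mu <= INR k) by (rewrite <- Hmu3; nra).
    rewrite Rabs_pos_eq by nra.
    (* The first factor is at most c mu and, as mu <= k, the second is at most (2 + c) k, for c =
       [zero_gap]. *)
    replace (j ^ 2 - INR k ^ 2) with ((j - INR k) * (j + INR k)) by ring.
    replace (zero_gap * (2 + zero_gap) * (INR k * mu))
      with ((zero_gap * mu) * ((2 + zero_gap) * INR k)) by ring.
    apply Rmult_le_compat; nra.
  + rewrite <- (Rpower_1 (INR k)) at 1 by lra. unfold mu. rewrite <- Rpower_plus. f_equal. field.
- assert (Hlam : forall p, Rpower (j ^ 2) p = Rpower j (2 * p)).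
  { intros p. rewrite <- (Rpower_pow 2 j) by lra. rewrite Rpower_mult. reflexivity. }
  unfold inner_decay. intros r Hr0 Hr x y Hxy.
  rewrite sqrt_pow2 by lra. rewrite Hlam in Hr |- *.
  replace (2 * (1 / 6)) with (1 / 3) by field. fold nu.
  replace (2 * - (1 / 3)) with (- (1 / 3 * INR 2)) in Hr by (simpl; field).
  rewrite Rpower_Ropp, <- Rpower_mult, Rpower_pow in Hr by apply exp_pos. fold nu in Hr.
  assert (Hjr : j * r <= INR k).
  { apply Rle_trans with (j * (1 - zero_gap * / nu ^ 2)); [apply Rmult_le_compat_l; lra|].
    replace (j * (1 - zero_gap * / nu ^ 2)) with (j - zero_gap * nu)
      by (rewrite <- Hnu3; field; lra).
    nra. }
  assert (Hd := mode_decay k j r x y Hk ltac:(lra) Hr0 Hjr ltac:(lra)).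
  assert (HdA : 0 <= dA r) by (apply dA_nonneg; nra).
  unfold mode. rewrite Rabs_mult, (Rabs_pos_eq N) by lra.
  apply Rle_trans with (N * (bessel k (INR k ^ 2) * exp (- INR k * dA r)));
    [apply Rmult_le_compat_l; lra|].
  apply Rle_trans with (exp ((13 + 3 * zero_gap) * nu) * exp (- INR k * dA r)).
  + rewrite <- Rmult_assoc. apply Rmult_le_compat_r; [left; apply exp_pos | easy].
  + rewrite <- exp_plus. apply exp_le.
    (* C = 13 + 4c pays both for the normalization, 13 + 3c, and for replacing k by j in front of
       dA, which costs c. *)
    assert (Hkj : j - (13 + 4 * zero_gap) * nu <= INR k) by nra.
    assert (0 <= zero_gap * nu) by nra. nra.
Qed.

Theorem theorem1p12 :
  exists (psi : nat -> R -> R -> R) (lam : nat -> R),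
    (* psi_k in C^oo(D) cap H^1_0(D), lambda_k >= 0, ||psi_k||_2 = 1, -Delta psi_k = lambda_k psi_k *)
    (forall k : nat,
        smooth_closed_disk (psi k) /\
        (forall x y, x ^ 2 + y ^ 2 = 1 -> psi k x y = 0) /\
        0 <= lam k /\
        L2sq_disk (psi k) = 1 /\
        (forall x y, x ^ 2 + y ^ 2 < 1 ->
           - laplacian (psi k) x y = lam k * psi k x y)) /\
    (* lambda_k = k^2 + O(k^{4/3}) *)
    (exists M K : R, forall k : nat, K <= INR k ->
        Rabs (lam k - INR k ^ 2) <= M * Rpower (INR k) (4 / 3)) /\
    (* sup bound on B(0,r) *)
    (exists C beta k0 : R, 0 < C /\ 0 < beta /\ 0 < k0 /\
       forall k : nat, k0 <= INR k ->
       forall r : R, 0 < r -> r <= 1 - beta * Rpower (lam k) (- (1 / 3)) ->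
       forall x y : R, x ^ 2 + y ^ 2 < r ^ 2 ->
         Rabs (psi k x y) <=
           exp (- (sqrt (lam k) - C * Rpower (lam k) (1 / 6)) * dA r
                + C * Rpower (lam k) (1 / 6))).
Proof.
destruct (functional_choice (fun (k : nat) (p : (R -> R -> R) * R) =>
  dirichlet_eigenmode (fst p) (snd p) /\ ((1 <= k)%nat ->
    Rabs (snd p - INR k ^ 2) <= zero_gap * (2 + zero_gap) * Rpower (INR k) (4 / 3) /\
    inner_decay (13 + 4 * zero_gap) zero_gap (fst p) (snd p)))) as [f Hf].
{ intros k. destruct k as [|k].
  (* Index 0 borrows the mode of index 1: the asymptotics and the decay are claimed only from k = 1
     on. *)
  - destruct (eigenmode_exists 1 (le_n 1)) as [psi [lam [H _]]].
    exists (psi, lam). split; [easy | lia].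
  - destruct (eigenmode_exists (S k)) as [psi [lam [H1 H2]]]; [lia|]. now exists (psi, lam). }
assert (Hc : 0 < zero_gap) by (unfold zero_gap; assert (H := exp_pos 5); lra).
exists (fun k => fst (f k)), (fun k => snd (f k)). split; [|split].
- intros k. apply Hf.
- exists (zero_gap * (2 + zero_gap)), 1. intros k Hk. apply Hf, INR_le, Hk.
- exists (13 + 4 * zero_gap), zero_gap, 1. repeat split; try lra.
  intros k Hk. apply Hf, INR_le, Hk.
Qed.
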